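(* Let $\mathcal{C}$ be a finite skeletal EI-category with two objects $x$ and $y$ such that the groups $\operatorname{End}(x)$ and $\operatorname{End}(y)$ are non-trivial and their product $\operatorname{End}(x)\times\operatorname{End}(y)$ acts freely on $\mathcal{C}(x,y)$. Then $k\mathcal{C}$ is of infinite representation type for any algebraically closed field $k$.
   Context: An EI-category is a category in which every endomorphism is an isomorphism (so $\operatorname{End}(z)=\operatorname{Aut}(z)$ is a group for every object $z$); it is finite if it has finitely many morphisms, and skeletal if isomorphic objects are equal. $\mathcal{C}(x,y)$ is the set of morphisms from $x$ to $y$. The group $\operatorname{End}(x)\times\operatorname{End}(y)$ acts on $\mathcal{C}(x,y)$ by composition: $(g,h)\cdot f=h\circ f\circ g^{-1}$; the action is free if all stabilisers are trivial. The category algebra $k\mathcal{C}$ is the $k$-algebra with $k$-basis the set of morphisms of $\mathcal{C}$ and multiplication induced by composition (the product of two non-composable morphisms is $0$). A finite-dimensional $k$-algebra is of finite representation type if it has only finitely many isomorphism classes of finite-dimensional indecomposable modules, and of infinite representation type otherwise.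
   Formalization: The formal theorem additionally assumes that C(x,y) is non-empty; without this the claim is false (no morphisms between x and y, both groups Z/2, char k ≠ 2: kC is semisimple, hence of finite representation type). *)

(* Defs.v *)
From HB Require Import structures.
From mathcomp Require Import all_boot all_order all_algebra all_fingroup all_field.

Set Implicit Arguments.
Unset Strict Implicit.
Unset Printing Implicit Defensive.

Import GRing.Theory.
Local Open Scope ring_scope.

(* A category with finitely many morphisms has finitely many objects. At least
   one object is required so that the category algebra is nonzero, as it must
   be to belong to the library's hierarchy of algebras.
   [ccomp g f] is the composite "g after f". *)
Record fincat := FinCat {
  ob :> finType;
  chom : ob -> ob -> finType;
  cid : forall a, chom a a;
  ccomp : forall a b c, chom b c -> chom a b -> chom a c;
  ccomp1c : forall a b (f : chom a b), ccomp (cid b) f = f;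
  ccompc1 : forall a b (f : chom a b), ccomp f (cid a) = f;
  ccompA : forall a b c d (h : chom c d) (g : chom b c) (f : chom a b),
    ccomp h (ccomp g f) = ccomp (ccomp h g) f;
  ob_gt0 : (0 < #|ob|)%N
}.

Section Isomorphisms.
Variable C : fincat.

Definition isom_mor (a b : C) (f : chom a b) : bool :=
  [exists g : chom b a, (ccomp g f == cid a) && (ccomp f g == cid b)].

Definition EI : Prop := forall (z : C) (f : chom z z), isom_mor f.

Definition skeletal : Prop := forall (a b : C) (f : chom a b), isom_mor f -> a = b.

End Isomorphisms.

Record eicat := EICat { eicat_cat :> fincat; eicatP : EI eicat_cat }.

Section EndGroup.
Variable C : eicat.

Definition End (z : C) : Type := chom z z.

HB.instance Definition _ (z : C) := Finite.on (End z).

Implicit Type z : C.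

Lemma endV_subproof z (f : End z) :
  exists g : End z, (ccomp g f == cid z) && (ccomp f g == cid z).
Proof. by have /existsP[g gP] := eicatP f; exists g. Qed.

Definition end_mul z (g f : End z) : End z := ccomp g f.
Definition end_one z : End z := cid z.
Definition end_inv z (f : End z) : End z := xchoose (endV_subproof f).

Lemma end_mulA z : associative (@end_mul z).
Proof. by move=> h g f; apply: ccompA. Qed.
Lemma end_mul1 z : left_id (end_one z) (@end_mul z).
Proof. by move=> f; apply: ccomp1c. Qed.
Lemma end_mulV z : left_inverse (end_one z) (@end_inv z) (@end_mul z).
Proof. by move=> f; have /andP[/eqP] := xchooseP (endV_subproof f). Qed.

HB.instance Definition _ z :=
  Finite_isGroup.Build (End z) (@end_mulA z) (@end_mul1 z) (@end_mulV z).

Variables x y : C.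

Definition hom_act (gh : End x * End y) (f : chom x y) : chom x y :=
  ccomp (ccomp (gh.2 : chom y y) f) ((gh.1)^-1%g : chom x x).

(* [hom_act] is a left action, whereas the library's [action]s are right
   actions. *)
Lemma hom_act1 f : hom_act 1%g f = f.
Proof. by rewrite /hom_act /= invg1 [LHS]ccompc1 [LHS]ccomp1c. Qed.

Lemma hom_actM gh gh' f : hom_act (gh * gh')%g f = hom_act gh (hom_act gh' f).
Proof.
rewrite /hom_act /= invMg.
by rewrite [(_ * _)%g]/(ccomp _ _) [((gh'.1)^-1 * _)%g]/(ccomp _ _) !ccompA.
Qed.

Definition hom_stab (f : chom x y) : {set End x * End y} :=
  [set gh | hom_act gh f == f].

Definition acts_freely : Prop := forall f : chom x y, hom_stab f = [set 1%g].

End EndGroup.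

Section CategoryAlgebra.
Variables (k : fieldType) (C : fincat).

Definition mor : finType := {a : C & {b : C & chom a b}}.
Definition Mor (a b : C) (f : chom a b) : mor :=
  existT (fun a => {b : C & chom a b}) a (existT (chom a) b f).
Definition mor_dom (m : mor) : C := projT1 m.
Definition mor_cod (m : mor) : C := projT1 (projT2 m).
Definition mor_arr (m : mor) : chom (mor_dom m) (mor_cod m) := projT2 (projT2 m).

(* An element is the family of its coefficients on the basis of morphisms. *)
Definition catalg : Type := {ffun mor -> k^o}.

HB.instance Definition _ := Vector.on catalg.

Implicit Types u v w : catalg.

Definition cat_basis (a b : C) (f : chom a b) : catalg :=
  [ffun m => (m == Mor f)%:R].

Definition cat_one : catalg := \sum_(a : C) cat_basis (cid a).

(* The coefficient of [m] is the sum of [u g * v f] over all factorizations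
   of [m] as "g after f"; see [cat_basisM] and [cat_basisM0] below. *)
Definition cat_mul u v : catalg :=
  [ffun m => \sum_(b : C) \sum_(g : chom b (mor_cod m))
     \sum_(f : chom (mor_dom m) b | ccomp g f == mor_arr m) u (Mor g) * v (Mor f)].

Lemma cat_mulE u v (a c : C) (h : chom a c) :
  cat_mul u v (Mor h) = \sum_(b : C) \sum_(g : chom b c)
     \sum_(f : chom a b | ccomp g f == h) u (Mor g) * v (Mor f).
Proof. by rewrite ffunE. Qed.

Lemma catalgP u v : (forall (a b : C) (f : chom a b), u (Mor f) = v (Mor f)) -> u = v.
Proof. by move=> uv; apply/ffunP=> -[a [b f]]; apply: uv. Qed.

Lemma eq_Mor (a b : C) (f g : chom a b) : (Mor f == Mor g) = (f == g).
Proof. by rewrite /Mor !eq_Tagged. Qed.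

Lemma neq_Mor (a b a' b' : C) (f : chom a b) (g : chom a' b') :
  ~~ ((a == a') && (b == b')) -> (Mor f == Mor g) = false.
Proof.
by apply: contraNF => /eqP E; rewrite -[a]/(mor_dom (Mor f)) -[b]/(mor_cod (Mor f)) E !eqxx.
Qed.

Let sum_image (S T : finType) (P : pred T) (p : S -> T) (F : S -> k) :
  \sum_(t | P t) \sum_(s | p s == t) F s = \sum_(s | P (p s)) F s.
Proof.
rewrite [RHS](partition_big p P) //; apply: eq_bigr => t Pt.
by apply: eq_bigl => s; case: eqP => [->|]; rewrite ?Pt ?andbF.
Qed.

Lemma cat_mulA : associative cat_mul.
Proof.
move=> u v w; apply: catalgP => a d h; rewrite !cat_mulE.
transitivity (\sum_(b : C) \sum_(c : C) \sum_(g : chom b d) \sum_(g' : chom c b)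
   \sum_(f : chom a c | ccomp g (ccomp g' f) == h) u (Mor g) * (v (Mor g') * w (Mor f))).
  apply: eq_bigr => b _; rewrite exchange_big /=; apply: eq_bigr => g _.
  under eq_bigr => f _ do rewrite cat_mulE mulr_sumr.
  rewrite exchange_big /=; apply: eq_bigr => c _.
  under eq_bigr => f _ do rewrite mulr_sumr.
  rewrite exchange_big /=; apply: eq_bigr => g' _.
  under eq_bigr => f _ do rewrite mulr_sumr.
  exact: (sum_image (fun f => ccomp g f == h)).
rewrite exchange_big /=; apply: eq_bigr => c _; apply/esym.
transitivity (\sum_(l : chom c d) \sum_(b : C) \sum_(g : chom b d)
   \sum_(g' : chom c b | ccomp g g' == l) \sum_(f : chom a c | ccomp (ccomp g g') f == h)
     u (Mor g) * (v (Mor g') * w (Mor f))).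
  apply: eq_bigr => l _.
  under eq_bigr => f _ do rewrite cat_mulE mulr_suml.
  rewrite exchange_big /=; apply: eq_bigr => b _.
  under eq_bigr => f _ do rewrite mulr_suml.
  rewrite exchange_big /=; apply: eq_bigr => g _.
  under eq_bigr => f _ do rewrite mulr_suml.
  rewrite exchange_big /=; apply: eq_bigr => g' /eqP <-.
  by apply: eq_bigr => f _; rewrite mulrA.
rewrite exchange_big /=; apply: eq_bigr => b _.
rewrite exchange_big /=; apply: eq_bigr => g _.
rewrite (sum_image predT (ccomp g)); apply: eq_bigr => g' _.
by apply: eq_bigl => f; rewrite ccompA.
Qed.

Lemma cat_oneE (a b : C) (f : chom a b) :
  cat_one (Mor f) = (Mor f == Mor (cid a))%:R.
Proof.
rewrite /cat_one sum_ffunE (bigD1 a) //= [X in _ + X]big1 ?addr0 ?ffunE // => c ca.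
by rewrite ffunE neq_Mor // eq_sym (negPf ca).
Qed.

Lemma cat_mul1 : left_id cat_one cat_mul.
Proof.
move=> u; apply: catalgP => a c h; rewrite cat_mulE (bigD1 c) //= [X in _ + X]big1 ?addr0.
  rewrite (bigD1 (cid c)) //= [X in _ + X]big1 ?addr0.
    rewrite (big_pred1 h) => [|f]; last by rewrite ccomp1c.
    by rewrite cat_oneE eqxx mul1r.
  by move=> g gN1; apply: big1 => f _; rewrite cat_oneE eq_Mor (negPf gN1) mul0r.
move=> b bc; apply: big1 => g _; apply: big1 => f _.
by rewrite cat_oneE neq_Mor ?mul0r // eqxx eq_sym.
Qed.

Lemma cat_mulr1 : right_id cat_one cat_mul.
Proof.
move=> u; apply: catalgP => a c h; rewrite cat_mulE (bigD1 a) //= [X in _ + X]big1 ?addr0.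
  rewrite (bigD1 h) //= [X in _ + X]big1 ?addr0.
    rewrite (bigD1 (cid a)) ?ccompc1 //= [X in _ + X]big1 ?addr0.
      by rewrite cat_oneE eqxx mulr1.
    by move=> f /andP[_ fN1]; rewrite cat_oneE eq_Mor (negPf fN1) mulr0.
  move=> g gh; apply: big1 => f /eqP fE; rewrite cat_oneE eq_Mor.
  by case: eqP => [f1|]; rewrite ?mulr0 //; rewrite -fE f1 ccompc1 eqxx in gh.
move=> b ba; apply: big1 => g _; apply: big1 => f _.
by rewrite cat_oneE neq_Mor ?mulr0 // eqxx.
Qed.

Let addE u v m : (u + v) m = u m + v m. Proof. exact: ffunE. Qed.
Let scaleE (c : k) u m : (c *: u) m = c * u m. Proof. exact: ffunE. Qed.

Lemma cat_mulDl : left_distributive cat_mul +%R.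
Proof.
move=> u v w; apply: catalgP => a c h; rewrite addE !cat_mulE -big_split.
apply: eq_bigr => b _; rewrite -big_split; apply: eq_bigr => g _.
by rewrite -big_split; apply: eq_bigr => f _; rewrite addE mulrDl.
Qed.

Lemma cat_mulDr : right_distributive cat_mul +%R.
Proof.
move=> u v w; apply: catalgP => a c h; rewrite addE !cat_mulE -big_split.
apply: eq_bigr => b _; rewrite -big_split; apply: eq_bigr => g _.
by rewrite -big_split; apply: eq_bigr => f _; rewrite addE mulrDr.
Qed.

Lemma cat_one_neq0 : cat_one != 0.
Proof.
have /card_gt0P[a _] := ob_gt0 C; apply/eqP => /ffunP/(_ (Mor (cid a))).
by rewrite cat_oneE ffunE eqxx => /eqP; rewrite oner_eq0.
Qed.

HB.instance Definition _ := GRing.Zmodule_isNzRing.Build catalg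
  cat_mulA cat_mul1 cat_mulr1 cat_mulDl cat_mulDr cat_one_neq0.

Lemma cat_scaleAl (c : k) u v : c *: (u * v) = (c *: u) * v.
Proof.
apply: catalgP => a d h; rewrite scaleE !cat_mulE mulr_sumr.
apply: eq_bigr => b _; rewrite mulr_sumr; apply: eq_bigr => g _.
by rewrite mulr_sumr; apply: eq_bigr => f _; rewrite scaleE mulrA.
Qed.

HB.instance Definition _ := GRing.Lmodule_isLalgebra.Build k catalg cat_scaleAl.

Lemma cat_scaleAr (c : k) u v : c *: (u * v) = u * (c *: v).
Proof.
apply: catalgP => a d h; rewrite scaleE !cat_mulE mulr_sumr.
apply: eq_bigr => b _; rewrite mulr_sumr; apply: eq_bigr => g _.
by rewrite mulr_sumr; apply: eq_bigr => f _; rewrite scaleE mulrCA.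
Qed.

HB.instance Definition _ := GRing.Lalgebra_isAlgebra.Build k catalg cat_scaleAr.
HB.instance Definition _ := Algebra_isFalgebra.Build k catalg.

Lemma cat_basisM (a b c : C) (g : chom b c) (f : chom a b) :
  cat_basis g * cat_basis f = cat_basis (ccomp g f).
Proof.
apply: catalgP => a' c' h; rewrite [LHS]cat_mulE [RHS]ffunE.
have [/andP[/eqP Ea /eqP Ec]|NE] := boolP ((a' == a) && (c' == c)); last first.
  rewrite neq_Mor; last exact: NE.
  apply: big1 => b' _; apply: big1 => g' _; apply: big1 => f' _; rewrite !ffunE.
  case: (eqVneq (Mor g') (Mor g)) => [E|]; last by rewrite mul0r.
  have Ec : c' = c := congr1 (fun m => mor_cod m) E.
  case: (eqVneq (Mor f') (Mor f)) => [E'|]; last by rewrite mulr0.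
  have Ea : a' = a := congr1 (fun m => mor_dom m) E'.
  by rewrite Ea Ec !eqxx in NE.
subst a' c'; rewrite (bigD1 b) //= [X in _ + X]big1 ?addr0; last first.
  move=> b' b'b; apply: big1 => g' _; apply: big1 => f' _; rewrite !ffunE neq_Mor ?mul0r //.
  by rewrite (negPf b'b).
rewrite (bigD1 g) //= [X in _ + X]big1 ?addr0; last first.
  by move=> g' g'g; apply: big1 => f' _; rewrite !ffunE eq_Mor (negPf g'g) mul0r.
rewrite big_mkcond (bigD1 f) //= [X in _ + X]big1 ?addr0; last first.
  by move=> f' f'f; case: ifP => // _; rewrite !ffunE !eq_Mor (negPf f'f) mulr0.
by rewrite !ffunE !eqxx mulr1 eq_Mor eq_sym; case: eqP.
Qed.

Lemma cat_basisM0 (a b b' c : C) (g : chom b' c) (f : chom a b) :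
  b != b' -> cat_basis g * cat_basis f = 0.
Proof.
move=> bb'; apply: catalgP => a' c' h; rewrite [LHS]cat_mulE [RHS]ffunE.
apply: big1 => d _; apply: big1 => g' _; apply: big1 => f' _; rewrite !ffunE.
case: (eqVneq (Mor g') (Mor g)) => [E|]; last by rewrite mul0r.
have Eb' : d = b' := congr1 (fun m => mor_dom m) E.
case: (eqVneq (Mor f') (Mor f)) => [E'|]; last by rewrite mulr0.
have Eb : d = b := congr1 (fun m => mor_cod m) E'.
by rewrite -Eb -Eb' eqxx in bb'.
Qed.

End CategoryAlgebra.

Section RepresentationType.
Variables (k : fieldType) (A : falgType k).

(* Modules are left modules; [c : k] acts on an A-module through [c%:A]. *)
Definition fd_module (V : lmodType A) : Prop :=
  exists (n : nat) (e : 'I_n -> V),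
    forall v : V, exists c : 'I_n -> k, v = \sum_(i < n) (c i)%:A *: e i.

Definition isomorphic (V W : lmodType A) : Prop :=
  exists f : {linear V -> W}, bijective f.

Definition zero_module (V : lmodType A) : Prop := forall v : V, v = 0.

Definition indecomposable (V : lmodType A) : Prop :=
  ~ zero_module V /\
  forall U W : lmodType A,
    isomorphic V (U * W)%type -> zero_module U \/ zero_module W.

Definition finite_rep_type : Prop :=
  exists (n : nat) (M : 'I_n -> lmodType A),
    forall V : lmodType A, fd_module V -> indecomposable V ->
      exists i : 'I_n, isomorphic V (M i).

Definition infinite_rep_type : Prop := ~ finite_rep_type.

End RepresentationType.

(* Main.v *)
Require Import Defs.
From HB Require Import structures.
From mathcomp Require Import all_boot all_order all_algebra all_fingroup all_field.
From mathcomp Require Import ring.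
From Stdlib Require Import Classical.

(** Write G = End x and H = End y. In a skeletal EI-category with an arrow
    x -> y there is no arrow y -> x, so a module is a kG-module X, a kH-module Y
    and an equivariant family of linear maps X -> Y indexed by the arrows. Since
    G x H acts freely, the map attached to one chosen arrow f0 may be any linear
    map phi : X -> Y whatsoever; it determines the maps along the orbit of f0,
    and the other arrows may act by 0 ([catrep]).

    Two such modules on the same X and Y are isomorphic only if their maps phi
    are related by a kG-automorphism of X and a kH-automorphism of Y. Hence, when
    phi is invertible, the trace of phi g phi^-1 h is an isomorphism invariant
    for all g in G and h in H ([catrep_iso_trace]). Take X = Y = k[G x H], with
    G and H acting by translation of their own factor, and let phi run through a
    one-parameter group of transvections 1 + t E with E ^ 2 = 0 and E of rank 1.
    For g and h both different from 1, a suitable E makes the trace a polynomial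
    in t of degree exactly 2 ([trace_transvection]), and so every element of the
    algebraically closed field k is the invariant of some module in the family.

    This is impossible for an algebra of finite representation type: splitting
    off summands until they are indecomposable shows that it has only finitely
    many isomorphism classes of modules of each bounded dimension
    ([finite_rep_type_dim_le]), whereas k is infinite. *)

Set Implicit Arguments.
Unset Strict Implicit.
Unset Printing Implicit Defensive.

Import GRing.Theory.
Local Open Scope ring_scope.

(** * Isomorphisms of modules *)

Section Isomorphism.
Variables (k : fieldType) (A : falgType k).
Implicit Types U V W : lmodType A.

Lemma isomorphicI V W (f : V -> W) : linear f -> bijective f -> isomorphic V W.
Proof.
move=> f_lin f_bij.
pose fM := GRing.isLinear.Build A V W *:%R f f_lin.
pose F : {linear V -> W} := HB.pack f fM.
by exists F.
Qed.

Lemma isomorphic_sym V W : isomorphic V W -> isomorphic W V.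
Proof.
case=> f [g fK gK]; apply: (@isomorphicI _ _ g); last by exists f.
exact: can2_linear fK gK.
Qed.

Lemma isomorphic_trans V W U : isomorphic V W -> isomorphic W U -> isomorphic V U.
Proof.
case=> f f_bij [g g_bij]; apply: (@isomorphicI _ _ (g \o f)); last exact: bij_comp.
by move=> a u v; rewrite /= !linearP.
Qed.

Lemma isomorphic_prod V V' W W' :
  isomorphic V V' -> isomorphic W W' -> isomorphic (V * W)%type (V' * W')%type.
Proof.
case=> f [f' fK f'K] [g [g' gK g'K]].
apply: (@isomorphicI _ _ (fun p => (f p.1, g p.2))).
  by move=> a [u1 u2] [v1 v2]; congr pair; rewrite /= linearP.
by exists (fun p => (f' p.1, g' p.2)) => -[u v] /=; rewrite ?fK ?gK ?f'K ?g'K.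
Qed.

End Isomorphism.

(** * Modules of bounded dimension over an algebra of finite type *)

Section Dimension.
Variables (k : fieldType) (A : falgType k).
Implicit Types U V W : lmodType A.

Definition lin_indep V m (e : 'I_m -> V) : Prop :=
  forall c : 'I_m -> k, \sum_i (c i)%:A *: e i = 0 -> forall i, c i = 0.

(** Bounding the independent families rather than the generating ones makes it
    immediate that the bound drops when a nonzero summand is removed. *)
Definition dim_le V d : Prop :=
  forall m (e : 'I_m -> V), lin_indep e -> (m <= d)%N.

Lemma fd_module_iso V W : isomorphic V W -> fd_module V -> fd_module W.
Proof.
case=> f [g fK gK] [n [e eP]]; exists n, (f \o e) => w.
have [c cP] := eP (g w); exists c.
by rewrite -[LHS]gK cP linear_sum; apply: eq_bigr => i _; rewrite linearZ.
Qed.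

Lemma fd_module_fst V W : fd_module (V * W)%type -> fd_module V.
Proof.
case=> n [e eP]; exists n, (fun i => (e i).1) => v.
have [c cP] := eP (v, 0); exists c.
by rewrite -[LHS]/((v, 0 : W).1) cP raddf_sum.
Qed.

Lemma dim_le_iso V W d : isomorphic V W -> dim_le V d -> dim_le W d.
Proof.
case=> f [g fK gK] Vd m e e_free; apply: (Vd m (g \o e)) => c c0; apply: e_free.
rewrite -[RHS](linear0 f) -c0 linear_sum.
by apply: eq_bigr => i _; rewrite linearZ /= gK.
Qed.

Lemma isomorphic_swap V W : isomorphic (V * W)%type (W * V)%type.
Proof.
apply: (@isomorphicI _ _ _ _ (fun p => (p.2, p.1))) => //.
by exists (fun p => (p.2, p.1)) => -[].
Qed.

Lemma scale_alg_eq0 V (c : k) (v : V) : c%:A *: v = 0 -> v <> 0 -> c = 0.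
Proof.
move=> cv0 v0; apply/eqP/negPn/negP => c0; apply: v0.
by rewrite -[v]scale1r -[1 in LHS](scale1r (1 : A)) -(mulVf c0) -scalerA
  -mulr_algl -scalerA cv0 scaler0.
Qed.

(** A nonzero vector of W extends any independent family of V. *)
Lemma dim_le_fst V W d :
  dim_le (V * W)%type d.+1 -> ~ zero_module W -> dim_le V d.
Proof.
move=> VWd /not_all_ex_not[w w0] m e e_free; rewrite -ltnS.
pose e' (i : 'I_m.+1) : V * W :=
  if unlift ord0 i is Some j then (e j, 0) else (0, w).
apply: (VWd _ e') => c; rewrite big_ord_recl /e' unlift_none.
under eq_bigr do rewrite liftK.
move=> c0.
have /= := congr1 fst c0; rewrite raddf_sum /= scaler0 add0r => /e_free cj0.
have /= := congr1 snd c0; rewrite raddf_sum /= big1 => [|i _]; last exact: scaler0.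
rewrite addr0 => /scale_alg_eq0/(_ w0) cw0 i.
by have [j|] := unliftP ord0 i => -> //; apply: cj0.
Qed.

Lemma dim_le0 V : dim_le V 0 -> zero_module V.
Proof.
move=> V0 v; apply: NNPP => v0.
suff: lin_indep (fun _ : 'I_1 => v) by move=> /V0.
move=> c; rewrite big_ord1 => c0 i; rewrite ord1.
exact: scale_alg_eq0 c0 v0.
Qed.

Lemma zero_module_iso V W : zero_module V -> zero_module W -> isomorphic V W.
Proof.
move=> V0 W0; apply: (@isomorphicI _ _ _ _ (fun=> 0)).
  by move=> a u v; rewrite scaler0 addr0.
by exists (fun=> 0) => v; rewrite ?(V0 v) ?(W0 v).
Qed.

(** By induction on d. A decomposable module of dimension at most d + 1 is the
    product of two nonzero modules, each of dimension at most d, so ordered pairs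
    of the representatives found for d take care of it; the family given by
    finite representation type takes care of the indecomposable modules. *)
Lemma finite_rep_type_dim_le d : finite_rep_type A ->
  exists (J : finType) (N : J -> lmodType A),
    forall V, fd_module V -> dim_le V d -> exists j, isomorphic V (N j).
Proof.
case=> n [M MP]; elim: d => [|d [J [N NP]]].
  exists unit, (fun=> 'rV[A]_0 : lmodType A) => V _ /dim_le0 V0; exists tt.
  by apply: zero_module_iso => // v; rewrite [v]thinmx0.
exists (J + 'I_n + J * J)%type,
  (fun s => match s with inl (inl j) => N j | inl (inr i) => M i
    | inr (j1, j2) => (N j1 * N j2)%type end) => V V_fd Vd.
have [V0|V_neq0] := classic (zero_module V).
  have [|j Nj] := NP V V_fd; last by exists (inl (inl j)).
  move=> m e e_free; rewrite leqNgt; apply/negP => d_lt_m.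
  have m_gt0 : (0 < m)%N by apply: leq_ltn_trans d_lt_m.
  have e_dep : \sum_i (1 : k)%:A *: e i = 0 by rewrite [LHS]V0 [RHS]V0.
  by have /eqP := e_free (fun=> 1) e_dep (Ordinal m_gt0); rewrite oner_eq0.
have [V_indec|] := classic (indecomposable V).
  by have [i Mi] := MP V V_fd V_indec; exists (inl (inr i)).
move=> V_dec.
have [U [W [VUW [U0 W0]]]] :
    exists U W, isomorphic V (U * W)%type /\ ~ zero_module U /\ ~ zero_module W.
  apply: NNPP => noUW; apply: V_dec; split=> // U W VUW.
  have [|U0] := classic (zero_module U); [by left | right].
  by apply: NNPP => W0; apply: noUW; exists U, W.
have VWU := isomorphic_trans VUW (isomorphic_swap U W).
have [j1 U_iso] : exists j, isomorphic U (N j).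
  apply: NP; first exact: fd_module_fst (fd_module_iso VUW V_fd).
  exact: dim_le_fst (dim_le_iso VUW Vd) W0.
have [j2 W_iso] : exists j, isomorphic W (N j).
  apply: NP; first exact: fd_module_fst (fd_module_iso VWU V_fd).
  exact: dim_le_fst (dim_le_iso VWU Vd) U0.
exists (inr (j1, j2)); apply: isomorphic_trans VUW _.
exact: isomorphic_prod.
Qed.

End Dimension.

Lemma closed_field_infinite (k : closedFieldType) n :
  exists2 s : seq k, uniq s & size s = n.
Proof.
elim: n => [|n [s s_uniq sz_s]]; first by exists [::].
have /closed_nonrootP[a] : \prod_(b <- s) ('X - b%:P) != 0.
  by rewrite monic_neq0 // monic_prod_XsubC.
rewrite root_prod_XsubC => a_s.
by exists (a :: s); rewrite /= ?a_s ?sz_s.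
Qed.

(** Fewer isomorphism classes than values of the invariant: among more elements
    of k than there are classes in dimension at most d, two would be attained on
    isomorphic modules. *)
Lemma infinite_rep_type_invariant (k : closedFieldType) (A : falgType k) d
    (M : k -> lmodType A) (tau : k -> k) :
  (forall t, fd_module (M t)) -> (forall t, dim_le (M t) d) ->
  (forall t t', isomorphic (M t) (M t') -> tau t = tau t') ->
  (forall c, exists t, tau t = c) ->
  infinite_rep_type A.
Proof.
move=> M_fd M_dim tau_iso tau_surj /(finite_rep_type_dim_le d)[J [F FP]].
have [s s_uniq s_size] := closed_field_infinite k #|J|.+1.
have /fin_all_exists[j jP] (i : 'I_#|J|.+1) :
    exists j, exists2 t, tau t = s`_i & isomorphic (M t) (F j).
  have [t tE] := tau_surj s`_i.
  by have [j Fj] := FP (M t) (M_fd t) (M_dim t); exists j, t.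
suff /leq_card : injective j by rewrite card_ord ltnn.
move=> i i' jii'; have [t tE Mt] := jP i; have [t' t'E Mt'] := jP i'.
rewrite -jii' in Mt'.
have /tau_iso := isomorphic_trans Mt (isomorphic_sym Mt').
rewrite tE t'E => /eqP.
by rewrite nth_uniq ?s_size // => /eqP/val_inj.
Qed.

(** * Modules given by matrices *)

Section MatrixRepresentation.
Variables (k : fieldType) (A : falgType k) (D : nat).

Record matrep := MatRep {
  rep_mx :> {linear A -> 'M[k]_D};
  rep_mx1 : rep_mx 1 = 1%:M;
  rep_mxM : forall a b, rep_mx (a * b) = rep_mx a *m rep_mx b
}.

(** The argument is a phantom: it makes the action part of the type, so that the
    same space of columns can carry many module structures. *)
Definition repmod (r : matrep) : Type := 'cV[k]_D.

Section Module.
Variable r : matrep.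

HB.instance Definition _ := GRing.Zmodule.on (repmod r).

Definition repmod_scale (a : A) (v : repmod r) : repmod r := r a *m v.

Lemma repmod_scaleA a b v : repmod_scale a (repmod_scale b v) = repmod_scale (a * b) v.
Proof. by rewrite /repmod_scale rep_mxM mulmxA. Qed.
Lemma repmod_scale1 : left_id 1 repmod_scale.
Proof. by move=> v; rewrite /repmod_scale rep_mx1 mul1mx. Qed.
Lemma repmod_scaleDr : right_distributive repmod_scale +%R.
Proof. by move=> a u v; apply: mulmxDr. Qed.
Lemma repmod_scaleDl v : {morph repmod_scale^~ v : a b / a + b}.
Proof. by move=> a b; rewrite /repmod_scale linearD; apply: mulmxDl. Qed.

HB.instance Definition _ := GRing.Zmodule_isLmodule.Build A (repmod r)
  repmod_scaleA repmod_scale1 repmod_scaleDr repmod_scaleDl.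

Lemma repmod_scaleE (a : A) (v : repmod r) : a *: v = r a *m v :> 'cV_D.
Proof. by []. Qed.

Lemma repmod_algE (c : k) (v : repmod r) : c%:A *: v = c *: (v : 'cV_D).
Proof. by rewrite repmod_scaleE linearZ /= rep_mx1 -scalemxAl mul1mx. Qed.

Lemma repmod_fd : fd_module (repmod r).
Proof.
exists D, (fun i => delta_mx i 0) => v; exists (fun i => (v : 'cV_D) i 0).
rewrite [LHS](matrix_sum_delta (v : 'cV_D)); apply: eq_bigr => i _.
by rewrite big_ord1 repmod_algE.
Qed.

Lemma repmod_dim : dim_le (repmod r) D.
Proof.
move=> m e e_free; pose E := \matrix_(i < m, j < D) (e i : 'cV_D) j 0.
suff /eqP <- : row_free E by apply: rank_leq_col.
rewrite -kermx_eq0; apply/rowV0P => u /sub_kermxP uE0.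
apply/rowP => i; rewrite mxE; apply: (e_free (fun i => u 0 i)).
apply/matrixP => j l; rewrite ord1 mxE.
under eq_bigr do rewrite repmod_algE.
have := congr1 (fun M : 'rV_D => M 0 j) uE0; rewrite !mxE => <-.
by rewrite summxE; apply: eq_bigr => a _; rewrite !mxE.
Qed.

End Module.

Lemma repmod_iso (r s : matrep) : isomorphic (repmod r) (repmod s) ->
  exists2 P : 'M[k]_D, P \in unitmx & forall a, P *m r a = s a *m P.
Proof.
case=> f [g fK gK].
pose P := \matrix_(i, j) (f (delta_mx j 0) : 'cV_D) i 0.
have f_alg c v : f (c%:A *: v) = c *: (f v : 'cV_D) :> 'cV_D.
  by rewrite linearZ; apply: repmod_algE.
have fE v : f v = P *m v :> 'cV_D.
  have -> : f v = \sum_l (v : 'cV_D) l 0 *: (f (delta_mx l 0) : 'cV_D) :> 'cV_D.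
    rewrite [v in LHS](matrix_sum_delta (v : 'cV_D)).
    under eq_bigr do rewrite big_ord1 -(repmod_algE (r := r)).
    by rewrite linear_sum; apply: eq_bigr => l _; apply: f_alg.
  apply/colP => i; rewrite summxE mxE.
  by apply: eq_bigr => l _; rewrite !mxE mulrC.
exists P; last first.
  move=> a; suff PE (v : 'cV[k]_D) : (P *m r a) *m v = (s a *m P) *m v.
    by apply/trmx_inj/row_matrixP => i; rewrite -!tr_col !colE PE.
  by rewrite -!mulmxA -!fE -!repmod_scaleE linearZ.
pose Q := \matrix_(i, j) (g (delta_mx j 0) : 'cV_D) i 0.
suff /mulmx1_unit[] : P *m Q = 1%:M by [].
apply/trmx_inj/row_matrixP => j; rewrite -!tr_col; congr _^T.
suff -> : col j (P *m Q) = P *m g (delta_mx j 0) by rewrite -fE gK colE mul1mx.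
by rewrite colE -mulmxA; congr mulmx; apply/colP => i; rewrite -colE !mxE.
Qed.

End MatrixRepresentation.

(** * Matrices of functions on a finite set *)

Section MatrixOfFunction.
Variables (R : pzSemiRingType) (T : finType).

Definition fun_mx (s : T -> T) : 'M[R]_#|T| :=
  \matrix_(i, j) (enum_val i == s (enum_val j))%:R.

Lemma fun_mxE s a b :
  fun_mx s (enum_rank a) (enum_rank b) = (a == s b)%:R.
Proof. by rewrite mxE !enum_rankK. Qed.

Lemma eq_fun_mx s t : s =1 t -> fun_mx s = fun_mx t.
Proof. by move=> st; apply/matrixP => i j; rewrite !mxE st. Qed.

Lemma fun_mx_id : fun_mx id = 1%:M.
Proof. by apply/matrixP => i j; rewrite !mxE (inj_eq enum_val_inj). Qed.

Lemma fun_mx_comp s t : fun_mx (s \o t) = fun_mx s *m fun_mx t.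
Proof.
apply/matrixP => i j; rewrite !mxE (bigD1 (enum_rank (t (enum_val j)))) //=.
rewrite big1 ?addr0 => [|l l_neq]; first by rewrite !mxE enum_rankK eqxx mulr1.
have /negPf t_neq : enum_val l != t (enum_val j).
  by apply: contraNneq l_neq => <-; rewrite enum_valK.
by rewrite !mxE t_neq mulr0.
Qed.

End MatrixOfFunction.

(** * Traces along a line of transvections *)

Section Transvection.
Variables (R : comPzRingType) (N : nat) (u : 'cV[R]_N) (v : 'rV[R]_N).
Hypothesis vu0 : v *m u = 0.

Definition transvection (t : R) : 'M[R]_N := 1%:M + t *: (u *m v).

Lemma transvectionK t : transvection t *m transvection (- t) = 1%:M.
Proof.
rewrite /transvection mulmxDl mul1mx mulmxDr mulmx1 -scalemxAl -scalemxAr.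
have -> : u *m v *m (u *m v) = 0 by rewrite mulmxA -(mulmxA u) vu0 mulmx0 mul0mx.
by rewrite !scaler0 addr0 scaleNr -addrA addNr addr0.
Qed.

(** Writing E for u v, the quadratic term is the trace of E A E B, which is the
    product of the scalars v A u and v B u; normalizing both to 1 keeps it from
    vanishing in any characteristic. *)
Lemma trace_transvection (A B : 'M[R]_N) (t : R) :
  v *m A *m u = 1%:M -> v *m B *m u = 1%:M ->
  \tr (transvection t *m A *m transvection (- t) *m B)
    = \tr (A *m B) + t * \tr (u *m v *m A *m B - A *m (u *m v) *m B) - t ^+ 2.
Proof.
move=> vAu vBu; have vBu1 : \tr (u *m v *m B) = 1.
  by rewrite -mulmxA mxtrace_mulC vBu mxtrace1.
have EAEB : u *m v *m A *m (u *m v) *m B = u *m v *m B.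
  by rewrite -!mulmxA (mulmxA v A) (mulmxA (v *m A) u) vAu mul1mx.
rewrite /transvection !(mulmxDl, mulmxDr) !mul1mx !mulmx1 -!(scalemxAl, scalemxAr).
rewrite EAEB !(raddfD, raddfN) /= !mxtraceZ vBu1.
ring.
Qed.

End Transvection.

(** * Representations of a two-object category *)

Lemma sum_fiber (R : pzRingType) (V : lmodType R) (S T : finType) (p : S -> T)
    (F : S -> R) (G : T -> V) :
  \sum_t (\sum_(s | p s == t) F s) *: G t = \sum_s F s *: G (p s).
Proof.
rewrite [RHS](partition_big p predT) //=; apply: eq_bigr => t _.
by rewrite scaler_suml; apply: eq_bigr => s /eqP ->.
Qed.

Section CategoryRepresentation.
Variables (k : fieldType) (C : eicat) (x y : C).
Hypotheses (x_neq_y : x != y) (two_objects : forall z : C, z = x \/ z = y)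
  (no_back : chom y x -> False).
Variables (f0 : chom x y) (N : nat) (A : End x -> 'M[k]_N) (B : End y -> 'M[k]_N).
Hypotheses (A1 : A 1%g = 1%:M) (AM : forall g g', A (g * g')%g = A g *m A g').
Hypotheses (B1 : B 1%g = 1%:M) (BM : forall h h', B (h * h')%g = B h *m B h').

Lemma sum_objects (F : C -> k) : \sum_z F z = F x + F y.
Proof.
rewrite (bigD1 x) //= (big_pred1 y) // => z.
by case: (two_objects z) => ->; rewrite /= eqxx ?(negPf x_neq_y) // eq_sym x_neq_y.
Qed.

(** Sums run over [chom x x] and not over its alias [End x], although the
    summands use the group structure of the latter: the two finite types have
    the same elements but their enumerations are not convertible. *)
Definition xrep (u : catalg k C) : 'M[k]_N :=
  \sum_(g : chom x x) u (Mor g) *: A g.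
Definition yrep (u : catalg k C) : 'M[k]_N :=
  \sum_(h : chom y y) u (Mor h) *: B h.

Lemma xrep_linear : linear xrep.
Proof.
move=> c u v; rewrite /xrep scaler_sumr -big_split; apply: eq_bigr => g _.
by rewrite !ffunE scalerDl scalerA.
Qed.
Lemma yrep_linear : linear yrep.
Proof.
move=> c u v; rewrite /yrep scaler_sumr -big_split; apply: eq_bigr => h _.
by rewrite !ffunE scalerDl scalerA.
Qed.

Lemma xrepM u v : xrep (u * v) = xrep u *m xrep v.
Proof.
rewrite /xrep mulmx_suml.
transitivity (\sum_(g : chom x x) \sum_(g' : chom x x)
    (\sum_(f : chom x x | ccomp g' f == g) u (Mor g') * v (Mor f)) *: A g).
  apply: eq_bigr => g _; rewrite [(u * v) _]cat_mulE sum_objects -scaler_suml.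
  by rewrite [X in _ + X]big1 ?addr0 // => /no_back.
rewrite exchange_big; apply: eq_bigr => g _.
rewrite sum_fiber mulmx_sumr; apply: eq_bigr => g' _.
by rewrite -scalemxAl -scalemxAr scalerA -AM.
Qed.

Lemma yrepM u v : yrep (u * v) = yrep u *m yrep v.
Proof.
rewrite /yrep mulmx_suml.
transitivity (\sum_(g : chom y y) \sum_(g' : chom y y)
    (\sum_(f : chom y y | ccomp g' f == g) u (Mor g') * v (Mor f)) *: B g).
  apply: eq_bigr => g _; rewrite [(u * v) _]cat_mulE sum_objects -scaler_suml.
  rewrite [X in X + _]big1 ?add0r // => f _; apply: big1 => /no_back[].
rewrite exchange_big; apply: eq_bigr => g _.
rewrite sum_fiber mulmx_sumr; apply: eq_bigr => g' _.
by rewrite -scalemxAl -scalemxAr scalerA -BM.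
Qed.

Lemma xrep1 : xrep 1 = 1%:M.
Proof.
rewrite /xrep -A1 (bigD1 (cid _)) //= big1 => [|g gN1].
  by rewrite [(1 : catalg k C) _]cat_oneE eqxx scale1r addr0.
by rewrite [(1 : catalg k C) _]cat_oneE eq_Mor (negPf gN1) scale0r.
Qed.
Lemma yrep1 : yrep 1 = 1%:M.
Proof.
rewrite /yrep -B1 (bigD1 (cid _)) //= big1 => [|g gN1].
  by rewrite [(1 : catalg k C) _]cat_oneE eqxx scale1r addr0.
by rewrite [(1 : catalg k C) _]cat_oneE eq_Mor (negPf gN1) scale0r.
Qed.

Section Arrow.
Variable phi : 'M[k]_N.

(** The equivariant family of maps that sends f0 to phi: the arrow h f0 g^-1 acts
    as B h phi A g^-1. Indexing the sum in [xyrep] by pairs (g, h) instead of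
    arrows avoids choosing a pair for each arrow of the orbit, and lets the
    arrows outside the orbit act by 0. *)
Definition arrow_mx (p : End x * End y) : 'M[k]_N := B p.2 *m phi *m A p.1^-1%g.
Definition xyrep (u : catalg k C) : 'M[k]_N :=
  \sum_(p : chom x x * chom y y) u (Mor (hom_act p f0)) *: arrow_mx p.

Lemma xyrep_linear : linear xyrep.
Proof.
move=> c u v; rewrite /xyrep scaler_sumr -big_split; apply: eq_bigr => h _.
by rewrite !ffunE scalerDl scalerA.
Qed.

Lemma xyrep1 : xyrep 1 = 0.
Proof.
apply: big1 => p _; rewrite [(1 : catalg k C) _]cat_oneE neq_Mor ?scale0r //.
by rewrite eqxx eq_sym.
Qed.

Lemma sum_precomp (F : chom x y -> k) (g : End x) (p : End x * End y) :
  \sum_(m | ccomp m (g : chom x x) == hom_act p f0) F m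
    = F (hom_act ((g * p.1)%g, p.2) f0).
Proof.
have gV : ccomp (g : chom x x) (g^-1%g : chom x x) = cid x := mulgV g.
have Vg : ccomp (g^-1%g : chom x x) (g : chom x x) = cid x := mulVg g.
rewrite (big_pred1 (hom_act (g * p.1, p.2)%g f0)) // => m.
rewrite /hom_act /= invMg [(_ * _)%g]/(ccomp _ _) ccompA.
apply/eqP/eqP => [<-|->].
  by rewrite -ccompA gV ccompc1.
by rewrite -[LHS]ccompA Vg ccompc1.
Qed.

Lemma sum_postcomp (F : chom x y -> k) (h : End y) (p : End x * End y) :
  \sum_(m | ccomp (h : chom y y) m == hom_act p f0) F m
    = F (hom_act (p.1, (h^-1 * p.2)%g) f0).
Proof.
have hV : ccomp (h : chom y y) (h^-1%g : chom y y) = cid y := mulgV h.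
have Vh : ccomp (h^-1%g : chom y y) (h : chom y y) = cid y := mulVg h.
rewrite (big_pred1 (hom_act (p.1, h^-1 * p.2)%g f0)) // => m.
rewrite /hom_act /= [(_ * _)%g]/(ccomp _ _) -!ccompA.
apply/eqP/eqP => [<-|->].
  by rewrite ccompA Vh ccomp1c.
by rewrite [LHS]ccompA hV ccomp1c.
Qed.

(** Both summands are obtained by translating the index (g, h) of the orbit, in
    the first factor for precomposition and in the second for postcomposition. *)
Lemma xyrepM u v : xyrep (u * v) = xyrep u *m xrep v + yrep u *m xyrep v.
Proof.
transitivity (\sum_(p : chom x x * chom y y)
   ((\sum_(g : chom x x) u (Mor (hom_act ((g : End x) * p.1, p.2)%g f0)) * v (Mor g))
   *: arrow_mx p
   + (\sum_(h : chom y y) u (Mor h) * v (Mor (hom_act (p.1, (h : End y)^-1 * p.2)%g f0)))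
   *: arrow_mx p)).
  apply: eq_bigr => p _; rewrite [(u * v) _]cat_mulE sum_objects scalerDl.
  congr (_ *: _ + _ *: _).
    rewrite (exchange_big_dep predT) //=; apply: eq_bigr => g _.
    by rewrite -!mulr_suml (sum_precomp (fun m => u (Mor m))).
  by apply: eq_bigr => h _; rewrite -mulr_sumr (sum_postcomp (fun m => v (Mor m))).
rewrite big_split; congr (_ + _).
  under eq_bigr do rewrite scaler_suml.
  rewrite exchange_big /xrep mulmx_sumr; apply: eq_bigr => g _.
  rewrite mulmx_suml (reindex (fun q : chom x x * chom y y =>
    (((g : End x)^-1 * q.1)%g, q.2) : (chom x x * chom y y)%type)) /=.
    apply: eq_bigr => -[q1 q2] _ /=.
    by rewrite mulKVg /arrow_mx /= invMg invgK AM -scalemxAr -scalemxAl scalerA mulrC mulmxA.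
  exists (fun q : chom x x * chom y y =>
    (((g : End x) * q.1)%g, q.2) : (chom x x * chom y y)%type) => -[q1 q2] _ /=;
    by rewrite ?mulKg ?mulKVg.
under eq_bigr do rewrite scaler_suml.
rewrite exchange_big /yrep mulmx_suml; apply: eq_bigr => h _.
rewrite mulmx_sumr (reindex (fun q : chom x x * chom y y =>
    (q.1, ((h : End y) * q.2)%g) : (chom x x * chom y y)%type)) /=.
  apply: eq_bigr => -[q1 q2] _ /=.
  by rewrite mulKg /arrow_mx /= BM -scalemxAr -scalemxAl scalerA mulrC !mulmxA.
exists (fun q : chom x x * chom y y =>
    (q.1, ((h : End y)^-1 * q.2)%g) : (chom x x * chom y y)%type) => -[q1 q2] _ /=;
    by rewrite ?mulKg ?mulKVg.
Qed.

(** Matrices act on columns, and arrows lead from the x-component (upper block)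
    to the y-component (lower block), hence the lower triangular shape. *)
Definition catrep_mx (u : catalg k C) : 'M[k]_(N + N) :=
  block_mx (xrep u) 0 (xyrep u) (yrep u).

Lemma catrep_mx_linear : linear catrep_mx.
Proof.
move=> c u v; rewrite /catrep_mx xrep_linear xyrep_linear yrep_linear.
by rewrite scale_block_mx add_block_mx scaler0 addr0.
Qed.

HB.instance Definition _ :=
  GRing.isLinear.Build k (catalg k C) 'M[k]_(N + N) *:%R catrep_mx catrep_mx_linear.

Lemma catrep_mx1 : catrep_mx 1 = 1%:M.
Proof. by rewrite /catrep_mx xrep1 xyrep1 yrep1 -scalar_mx_block. Qed.

Lemma catrep_mxM u v : catrep_mx (u * v) = catrep_mx u *m catrep_mx v.
Proof.
by rewrite /catrep_mx mulmx_block xrepM xyrepM yrepM !mul0mx !mulmx0 !addr0 add0r.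
Qed.

Definition catrep : matrep (catalg k C) (N + N) := MatRep catrep_mx1 catrep_mxM.

Lemma catrepE u : catrep u = block_mx (xrep u) 0 (xyrep u) (yrep u).
Proof. by []. Qed.

Lemma catrep_End_x (g : End x) : catrep (Defs.cat_basis k (g : chom x x)) = block_mx (A g) 0 0 0.
Proof.
rewrite catrepE; congr block_mx.
- rewrite /xrep (bigD1 (g : chom x x)) //= big1 => [|g' gg'].
    by rewrite ffunE eqxx scale1r addr0.
  by rewrite ffunE eq_Mor (negPf gg') scale0r.
- apply: big1 => p _; rewrite ffunE neq_Mor ?scale0r //.
  by rewrite eqxx eq_sym.
- apply: big1 => h _; rewrite ffunE neq_Mor ?scale0r //.
  by rewrite eq_sym (negPf x_neq_y).
Qed.

Lemma catrep_End_y (h : End y) : catrep (Defs.cat_basis k (h : chom y y)) = block_mx 0 0 0 (B h).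
Proof.
rewrite catrepE; congr block_mx.
- apply: big1 => g _; rewrite ffunE neq_Mor ?scale0r //.
  by rewrite (negPf x_neq_y).
- apply: big1 => p _; rewrite ffunE neq_Mor ?scale0r //.
  by rewrite (negPf x_neq_y).
- rewrite /yrep (bigD1 (h : chom y y)) //= big1 => [|g' gg'].
    by rewrite ffunE eqxx scale1r addr0.
  by rewrite ffunE eq_Mor (negPf gg') scale0r.
Qed.

(** Freeness enters here: only the pair (1, 1) contributes to the action of f0. *)
Lemma catrep_arrow : hom_stab f0 = [set 1%g] ->
  catrep (Defs.cat_basis k f0) = block_mx 0 0 phi 0.
Proof.
move=> f0_free; rewrite catrepE; congr block_mx.
- apply: big1 => g _; rewrite ffunE neq_Mor ?scale0r //.
  by rewrite eqxx (negPf x_neq_y).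
- rewrite /xyrep (bigD1 (cid x, cid y)) //= big1 => [|p pN1].
    by rewrite ffunE hom_act1 eqxx scale1r addr0 /arrow_mx /= invg1 A1 B1 mul1mx mulmx1.
  have /setP/(_ p) := f0_free; rewrite !inE (negPf pN1) => pf0.
  by rewrite ffunE eq_Mor pf0 scale0r.
- apply: big1 => h _; rewrite ffunE neq_Mor ?scale0r //.
  by rewrite eq_sym (negPf x_neq_y).
Qed.

End Arrow.

(** The identity of x forces an isomorphism to be block diagonal; its blocks Pa
    and Pd commute with G and with H, and satisfy phi' Pa = Pd phi. They cancel
    in the trace, which is invariant under cyclic permutation. *)
Lemma catrep_iso_trace phi psi phi' psi' g h : hom_stab f0 = [set 1%g] ->
  phi *m psi = 1%:M -> phi' *m psi' = 1%:M ->
  isomorphic (repmod (catrep phi)) (repmod (catrep phi')) ->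
  \tr (phi *m A g *m psi *m B h) = \tr (phi' *m A g *m psi' *m B h).
Proof.
move=> f0_free phiK phi'K /repmod_iso[P P_unit PE].
have [Q PQ] : exists Q, P *m Q = 1%:M by exists (invmx P); apply: mulmxV.
rewrite -[P]submxK -[Q]submxK in PQ.
rewrite -[P]submxK in PE.
set Pa := ulsubmx P in PE PQ; set Pb := ursubmx P in PE PQ.
set Pc := dlsubmx P in PE PQ; set Pd := drsubmx P in PE PQ.
(* cid x, read in the group End x, acts as the projection on the x-component. *)
have := PE (Defs.cat_basis k (cid x)).
rewrite !(catrep_End_x _ (1%g : End x)) !mulmx_block.
rewrite !(mulmx0, mul0mx, addr0, add0r) A1 !(mulmx1, mul1mx).
move=> /eq_block_mx[_ Pb0 Pc0 _].
rewrite -Pb0 Pc0 in PE PQ.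
move: PQ; rewrite mulmx_block scalar_mx_block !(mul0mx, addr0, add0r).
set Qa := ulsubmx _; set Qd := drsubmx _.
move=> /eq_block_mx[PaQa _ _ PdQd].
have := PE (Defs.cat_basis k (g : chom x x)).
rewrite !catrep_End_x !mulmx_block !(mulmx0, mul0mx, addr0, add0r).
move=> /eq_block_mx[PaA _ _ _].
have := PE (Defs.cat_basis k (h : chom y y)).
rewrite !catrep_End_y !mulmx_block !(mulmx0, mul0mx, addr0, add0r).
move=> /eq_block_mx[_ _ _ PdB].
have := PE (Defs.cat_basis k f0).
rewrite !catrep_arrow // !mulmx_block !(mulmx0, mul0mx, addr0, add0r).
move=> /eq_block_mx[_ _ Pphi _].
have phi'E : phi' = Pd *m phi *m Qa by rewrite Pphi -mulmxA PaQa mulmx1.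
have psi'E : psi' = Pa *m psi *m Qd.
  have phi'K2 : phi' *m (Pa *m psi *m Qd) = 1%:M.
    by rewrite !mulmxA -Pphi -(mulmxA Pd) phiK mulmx1.
  by rewrite -[RHS]mul1mx -(mulmx1C phi'K) -(mulmxA psi') phi'K2 mulmx1.
have QaA : Qa *m A g *m Pa = A g by rewrite -mulmxA -PaA mulmxA (mulmx1C PaQa) mul1mx.
have QdB : Qd *m B h = B h *m Qd.
  by rewrite -[LHS]mulmx1 -PdQd -mulmxA (mulmxA (B h)) -PdB !mulmxA (mulmx1C PdQd) mul1mx.
rewrite phi'E psi'E !mulmxA -(mulmxA _ Qd) QdB !mulmxA.
rewrite -(mulmxA (Pd *m phi) Qa) -(mulmxA (Pd *m phi) (Qa *m A g)) QaA.
by rewrite [RHS]mxtrace_mulC !mulmxA (mulmx1C PdQd) mul1mx.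
Qed.

End CategoryRepresentation.

(** * Infinite representation type *)

(** For an arrow f : x -> y and a second one back, both composites are
    invertible, so f would have a left and a right inverse. *)
Lemma skeletal_no_back (C : eicat) (x y : C) : skeletal C -> x != y ->
  chom x y -> chom y x -> False.
Proof.
move=> C_skel /eqP xy f p; apply: xy; apply: (C_skel _ _ f).
have /existsP[q /andP[/eqP qpf _]] := eicatP (ccomp p f).
have /existsP[r /andP[_ /eqP fpr]] := eicatP (ccomp f p).
have E : ccomp q p = ccomp p r.
  by rewrite -[LHS]ccompc1 -fpr -ccompA !ccompA -(ccompA q) qpf ccomp1c.
apply/existsP; exists (ccomp q p).
by rewrite -ccompA qpf eqxx E ccompA fpr eqxx.
Qed.

Theorem theorem4p5 (C : eicat) (x y : C)
    (x_neq_y : x != y)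
    (two_objects : forall z : C, z = x \/ z = y)
    (C_skeletal : skeletal C)
    (End_x_nontrivial : [set: End x] != 1%g)
    (End_y_nontrivial : [set: End y] != 1%g)
    (hom_nonempty : (0 < #|chom x y|)%N)
    (free_action : acts_freely x y)
    (k : closedFieldType) :
  infinite_rep_type (catalg k C).
Proof.
have /trivgPn[g _ gN1] := End_x_nontrivial.
have /trivgPn[h _ hN1] := End_y_nontrivial.
have /card_gt0P[f0 _] := hom_nonempty.
have no_back := skeletal_no_back C_skeletal x_neq_y f0.
pose T : finType := (End x * End y)%type.
pose sx (a : End x) (p : T) : T := ((a * p.1)%g, p.2).
pose sy (b : End y) (p : T) : T := (p.1, (b * p.2)%g).
pose A (a : End x) : 'M[k]_#|T| := fun_mx k (sx a).
pose B (b : End y) : 'M[k]_#|T| := fun_mx k (sy b).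
have A1 : A 1%g = 1%:M.
  by rewrite -fun_mx_id; apply: eq_fun_mx => -[a b]; rewrite /sx mul1g.
have B1 : B 1%g = 1%:M.
  by rewrite -fun_mx_id; apply: eq_fun_mx => -[a b]; rewrite /sy mul1g.
have AM a a' : A (a * a')%g = A a *m A a'.
  by rewrite -fun_mx_comp; apply: eq_fun_mx => -[c d]; rewrite /sx /= mulgA.
have BM b b' : B (b * b')%g = B b *m B b'.
  by rewrite -fun_mx_comp; apply: eq_fun_mx => -[c d]; rewrite /sy /= mulgA.
(* v pairs to 0 with the basis vector u of (1, 1), but to 1 with its translates
   by g and by h, because neither g nor h is 1. *)
pose u : 'cV[k]_#|T| := delta_mx (enum_rank (1%g : T)) 0.
pose v : 'rV[k]_#|T| := delta_mx 0 (enum_rank ((g, 1%g) : T))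
  + delta_mx 0 (enum_rank ((1%g, h) : T)).
have vMu s : v *m fun_mx k s *m u
    = (((g, 1%g) == s 1%g)%:R + ((1%g, h) == s 1%g)%:R)%:M.
  rewrite !mulmxDl -!rowE -!colE; apply/matrixP => i j.
  by rewrite !ord1 [LHS]mxE !(fun_mxE, mxE) mulr1n.
have vu0 : v *m u = 0.
  have := vMu id; rewrite fun_mx_id mulmx1 => ->.
  by rewrite !xpair_eqE (negPf gN1) (negPf hN1) andbF addr0 raddf0.
have vAu : v *m A g *m u = 1%:M.
  by rewrite vMu /sx /= !mulg1 eqxx xpair_eqE (negPf hN1) andbF addr0.
have vBu : v *m B h *m u = 1%:M.
  by rewrite vMu /sy /= !mulg1 eqxx xpair_eqE (negPf gN1) add0r.
pose M t := catrep x_neq_y two_objects no_back f0 A1 AM B1 BM (transvection u v t).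
pose tau t := \tr (transvection u v t *m A g *m transvection u v (- t) *m B h).
apply: (@infinite_rep_type_invariant _ _ (#|T| + #|T|) (fun t => repmod (M t)) tau).
- by move=> t; apply: repmod_fd.
- by move=> t; apply: repmod_dim.
- move=> t t'; apply: catrep_iso_trace (free_action f0) _ _; exact: transvectionK.
move=> c; set b := \tr (u *m v *m A g *m B h - A g *m (u *m v) *m B h).
(* tau t = c is the monic equation t ^ 2 = (tr (A g B h) - c) + b t. *)
have [t tE] := solve_monicpoly (fun i => [:: \tr (A g *m B h) - c; b]`_i) (isT : (0 < 2)%N).
exists t; rewrite /tau trace_transvection // -/b tE !big_ord_recl big_ord0 /=.
by rewrite expr0 expr1; ring.
Qed.
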